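(* For every nondegenerate interval $I \subset \mathbb{R}$ and every $\theta \in [0,1]$ there exists a max-family $(f_n \colon I \to \mathbb{R})_{n=1}^\infty$ of continuous functions such that $\dim_H(I_f \cap U) = \theta$ for every nonempty open subinterval $U$ of $I$.
   Context: For a sequence $(f_n)_{n=1}^\infty$ of continuous functions $f_n \colon I \to \mathbb{R}$ with $f_1 \le f_2 \le \cdots$ (pointwise), define $I_f := \{x \in I : \lim_{n\to\infty} f_n(x) = +\infty\}$. Such a sequence (continuous and pointwise nondecreasing in $n$) is called a max-family if $\lim_{n\to\infty} \int_x^y f_n(t)\,dt = +\infty$ for all $x,y \in I$ with $x<y$. $\dim_H$ denotes Hausdorff dimension. *)

(* Defs.v *)
From HB Require Import structures.
From mathcomp Require Import all_boot all_order all_algebra.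
From mathcomp Require Import all_classical all_reals all_analysis.

Set Implicit Arguments.
Unset Strict Implicit.
Unset Printing Implicit Defensive.

Import Order.TTheory GRing.Theory Num.Theory.
Import numFieldNormedType.Exports.

Local Open Scope classical_set_scope.
Local Open Scope ring_scope.

Section Hausdorff.
Context {R : realType}.
Implicit Types (A : set R) (s d : R).
Local Open Scope ereal_scope.

(* For the empty set this is the supremum of the empty set, i.e. -oo. *)
Definition diam A : \bar R :=
  ereal_sup [set `|x.1 - x.2|%:E | x in A `*` A].

(* The empty set weighs 0 for every s, including s = 0; a nonempty set weighs
   (diam A)^s with 0^0 = 1, so the measure with s = 0 is counting measure.
   Since empty sets weigh 0, countable covers include the finite ones. *)
Definition hausdorff_gauge s A : \bar R :=
  if pselect (A = set0) then 0 else diam A `^ s.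

Definition hausdorff_premeasure s d A : \bar R :=
  ereal_inf [set \sum_(0 <= i <oo) hausdorff_gauge s (B i) | B in
    [set B : nat -> set R |
       A `<=` \bigcup_i B i /\ forall i, diam (B i) <= d%:E]].

(* The premeasure is nonincreasing in d, so its limit as d tends to 0+ is the
   supremum over d > 0. *)
Definition hausdorff_outer_measure s A : \bar R :=
  ereal_sup [set hausdorff_premeasure s d A | d in [set d | (0 < d)%R]].

Definition hausdorff_dim A : \bar R :=
  ereal_inf [set s%:E | s in
    [set s | (0 <= s)%R /\ hausdorff_outer_measure s A = 0]].

End Hausdorff.

Section MaxFamily.
Context {R : realType}.

(* A real function on I is represented by a total function R -> R, of which
   only the values on I are ever used. *)
Record max_family (I : set R) (f : nat -> R -> R) : Prop := MaxFamily {
  max_family_continuous : forall n, {within I, continuous (f n)} ;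
  max_family_nondecreasing :
    forall x, I x -> nondecreasing_seq (fun n => f n x) ;
  max_family_integral : forall x y, I x -> I y -> x < y ->
    (\int[lebesgue_measure]_(t in `[x, y]) (f n t)%:E)%E @[n --> \oo]
      --> +oo%E }.

Definition blowup_set (I : set R) (f : nat -> R -> R) : set R :=
  [set x | I x /\ f n x @[n --> \oo] --> +oo].

End MaxFamily.

(* Main.v *)
Require Import Defs.
From mathcomp Require Import all_boot all_order all_algebra.
From mathcomp Require Import all_classical all_reals all_analysis.
From mathcomp Require Import measurable_realfun.
From mathcomp Require Import zify lra.

Import Order.TTheory GRing.Theory Num.Theory.
Import numFieldNormedType.Exports.

Local Open Scope classical_set_scope.
Local Open Scope ring_scope.

(* Suppose that E is covered infinitely often by balls B(c_i, r_i) with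
   sum_i r_i^s < oo for every s > theta.  Then f_n, the sum of the first n
   bumps of height 2/r_i supported in B(c_i, 2r_i), tends to +oo on E, while its
   blow-up set lies in the limsup of the balls B(c_i, 2r_i), which is null for
   the s-dimensional Hausdorff measure for all s > theta.  If E is dense then
   every interval contains infinitely many of the balls B(c_i, r_i), and each
   of these contributes at least 1 to the integral of f_n.

   It remains to find a dense E that has such a cover and has dimension at least
   theta in every interval.  For theta = 0 take the rationals.  For theta > 0
   take the rational translates of psi([0, 1[), where psi expands distances,
   |t - u| <= K |psi t - psi u|^theta, so that the dimension of psi(J) is at least
   theta for every interval J by comparison with Lebesgue measure, but maps dyadic
   intervals of length 2^-N into intervals of length at most 2K lam^N, with
   lam = 2^(-1/theta), which yields the cover.  For theta = 1 the identity is such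
   a psi; for theta < 1 one is the pure jump function
   t |-> sum_n lam^n floor(2^n t), which jumps by at least lam^N at every
   multiple of 2^-N and whose image is a Cantor set. *)

(** * Sums of powers and limsup covers *)

Lemma nneseries_lty {R : realType} (u : nat -> R) (M : R) :
  (forall n, 0 <= u n) -> (forall n, series u n <= M) ->
  (\sum_(0 <= i <oo) (u i)%:E < +oo)%E.
Proof.
move=> u0 uM; apply: (@le_lt_trans _ _ M%:E); last exact: ltry.
apply: lime_le; first by apply: is_cvg_nneseries => n _ _; rewrite lee_fin.
by apply: nearW => n; rewrite sumEFin lee_fin; exact: uM.
Qed.

Lemma nneseries_tail_lt {R : realType} {u : nat -> R} (e : R) :
  (forall n, 0 <= u n) -> (\sum_(0 <= i <oo) (u i)%:E < +oo)%E -> 0 < e ->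
  exists N, (\sum_(0 <= i <oo) (u (i + N)%N)%:E < e%:E)%E.
Proof.
move=> u0 uoo e0.
have u0' n : (0 <= (u n)%:E)%E by rewrite lee_fin.
have /(_ _)/(_ (open_ereal_lt' (_ : 0%:E < e%:E)%E)) :=
  @nneseries_tail_cvg R (fun i => (u i)%:E) xpredT uoo (fun k _ => u0' k).
rewrite lte_fin => /(_ e0)[N _ NP]; exists N.
by rewrite (nneseries_addn (f := fun i => (u i)%:E))//; exact: (NP N (leqnn N)).
Qed.

Lemma nneseries_ge_term {R : realType} (u : nat -> R) i :
  (forall n, 0 <= u n) -> ((u i)%:E <= \sum_(0 <= n <oo) (u n)%:E)%E.
Proof.
move=> u0; apply: le_trans (nneseries_lim_ge (m := 0%N) i.+1 _); last first.
  by move=> n _ _; rewrite lee_fin.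
by rewrite big_nat_recr//= leeDr// sume_ge0// => j _; rewrite lee_fin.
Qed.

Lemma powR_le_inv {R : realType} (s a b : R) :
  0 < s -> 0 <= a -> 0 <= b -> a `^ s <= b `^ s -> a <= b.
Proof.
move=> s0 a0 b0; rewrite !leNgt; apply: contra => ba.
by apply: gt0_ltr_powR => //; rewrite nnegrE.
Qed.

(* Covers are kept as sequences (and not as values of an outer measure) so that
   the same balls serve both to build the functions and to bound the dimension. *)
Definition limsup_cover {R : realType} (theta : R) (E : set R) :=
  exists c r : nat -> R,
    [/\ forall i, 0 < r i,
        forall s, theta < s -> (\sum_(0 <= i <oo) (r i `^ s)%:E < +oo)%E &
        forall x, E x -> forall N, exists2 i, (N <= i)%N & `|x - c i| <= r i].

(* The k-th cover is truncated so that its (theta + 1/(k+1))-sum is at most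
   2^-k, and the truncated covers are interleaved. *)
Lemma limsup_cover_bigcup {R : realType} (theta : R) (E : nat -> set R) :
  0 <= theta -> (forall k, limsup_cover theta (E k)) ->
  limsup_cover theta (\bigcup_k E k).
Proof.
move=> t0 covE.
have [c cP] := choice covE.
have {covE cP}[r rP] := choice cP.
pose s_ k : R := theta + k.+1%:R^-1.
have ts k : theta < s_ k by rewrite ltrDl invr_gt0.
have s0 k : 0 < s_ k by exact: le_lt_trans (ts k).
have : forall k, exists N,
    (\sum_(0 <= i <oo) (r k (i + N)%N `^ s_ k)%:E < (2^-1 ^+ k)%:E)%E.
  move=> k; have [_ /(_ _ (ts k)) rk _] := rP k.
  apply: (nneseries_tail_lt _ _ rk) => [n|]; first exact: powR_ge0.
  by rewrite exprn_gt0// invr_gt0.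
move=> /choice[N_ NP].
pose C k i := c k (i + N_ k)%N; pose D k i := r k (i + N_ k)%N.
have D0 k i : 0 < D k i by have [+ _ _] := rP k; exact.
(* Each term of a sum below [2^-k <= 1] is at most 1. With radii at most 1, raising the exponent can
   only decrease the powers. *)
have D1 k i : D k i <= 1.
  apply: (@powR_le_inv _ (s_ k)) => //; first exact: ltW.
  rewrite powR1 -lee_fin (@le_trans _ _ (2^-1 ^+ k)%:E)//; last first.
    by rewrite lee_fin exprn_ile1// invf_le1// ler1n.
  apply: le_trans (ltW (NP k)).
  by apply: (nneseries_ge_term (fun i => D k i `^ s_ k)) => n; exact: powR_ge0.
have /card_esym/ppcard_eqP[f] := card_nat2.
exists (fun m => C (f m).1 (f m).2), (fun m => D (f m).1 (f m).2); split.
- by move=> i; exact: D0.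
- move=> s ls.
  have Ds0 k i : (0 <= (D k i `^ s)%:E)%E by rewrite lee_fin powR_ge0.
  pose S k := (\sum_(0 <= i <oo) (D k i `^ s)%:E)%E.
  have S0 k : (0 <= S k)%E by exact: nneseries_ge0.
  have Soo k : (S k < +oo)%E.
    have [_ /(_ _ ls) rk _] := rP k.
    apply: le_lt_trans rk; rewrite /S.
    rewrite (nneseries_addn (f := fun i => (r k i `^ s)%:E)); last first.
      by move=> i; rewrite lee_fin powR_ge0.
    rewrite ereal_series; apply: subset_lee_nneseries => //.
    by move=> i _; rewrite lee_fin powR_ge0.
  have -> : (\sum_(0 <= i <oo) (D (f i).1 (f i).2 `^ s)%:E = \sum_(0 <= k <oo) S k)%E.
    transitivity (\esum_(l in [set: nat] `*` [set: nat]) (D l.1 l.2 `^ s)%:E)%E.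
      rewrite (reindex_esum [set: nat] _ f)//; last first.
        have := @bijTT _ _ f.
        by rewrite -setTT_bijective/= -[in X in set_bij _ X _ -> _](@setXTT nat nat).
      by rewrite nneseries_esumT.
    rewrite (_ : _ `*` _ = setT `*`` (fun=> setT)); last by apply/seteqP; split.
    rewrite -(@esum_esum _ _ _ _ _ (fun i j => (D i j `^ s)%:E))//.
    by rewrite nneseries_esumT//; apply: eq_esum => i _; rewrite /S nneseries_esumT.
  (* For [k >= k0] one has [s_ k <= s], hence [S k <= 2^-k]; the earlier [S k] are finitely many
     finite terms. *)
  have [k0 k0P] : exists k0 : nat, k0.+1%:R^-1 < s - theta.
    by have [k hk] := ltr_add_invr ls; exists k; rewrite ltrBrDl.
  rewrite (nneseries_split 0%N k0)//.
  rewrite add0n; apply: lte_add_pinfty; first by apply: lte_sum_pinfty => i _; exact: Soo.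
  apply: (@le_lt_trans _ _ (\sum_(k0 <= k <oo) (2^-1 ^+ k)%:E)%E).
    rewrite [leLHS]ereal_series [leRHS]ereal_series.
    apply: lee_nneseries => // k kk0; apply: le_trans (ltW (NP k)).
    apply: lee_nneseries => // i _; rewrite lee_fin ger_powR ?D0 ?D1//.
    rewrite /s_ -lerBrDl; apply: le_trans (ltW k0P).
    by rewrite lef_pV2 ?posrE// ler_nat.
  apply: (@le_lt_trans _ _ (\sum_(0 <= k <oo) (2^-1 ^+ k)%:E)%E).
    rewrite ereal_series; apply: subset_lee_nneseries => // i; rewrite lee_fin exprn_ge0.
  apply: (@nneseries_lty _ _ (1 * (1 - 2^-1)^-1)) => [n|n]; first by rewrite exprn_ge0.
  rewrite exprn_geometric; apply: geometric_le_lim => //.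
  by rewrite ger0_norm// invf_lt1// ltr1n.
- move=> x [k _ Ekx] N.
  have [_ _ /(_ _ Ekx) hk] := rP k.
  (* Every pair enumerated before [N] has second coordinate below [M], so a pair with second
     coordinate at least [M] has index at least [N]. *)
  pose M := \max_(m < N) (f m).2.+1.
  have [i Mi xi] := hk (M + N_ k)%N.
  have iN : (N_ k <= i)%N by apply: leq_trans Mi; rewrite leq_addl.
  exists (f^-1%FUN (k, (i - N_ k)%N)); last first.
    by rewrite invK ?inE//= /C /D/= subnK.
  rewrite leqNgt; apply/negP => mN.
  have := @leq_bigmax _ (fun m : 'I_N => (f m).2.+1) (Ordinal mN).
  rewrite /= invK ?inE//= -/M => lM.
  by move: Mi; rewrite -{1}(subnK iN) leq_add2r leqNgt lM.
Qed.

(** * Bounds on the Hausdorff dimension *)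

Section Hausdorff.
Context {R : realType}.
Implicit Types (A : set R) (s d K theta : R).

Lemma diam_ge A x y : A x -> A y -> (`|x - y|%:E <= diam A)%E.
Proof. by move=> Ax Ay; apply: ereal_sup_ubound; exists (x, y). Qed.

Lemma diam_ge0 A : A !=set0 -> (0 <= diam A)%E.
Proof. by move=> [x Ax]; have := diam_ge _ _ _ Ax Ax; rewrite subrr normr0. Qed.

Lemma hausdorff_gauge_set0 s : hausdorff_gauge s (set0 : set R) = 0%E.
Proof. by rewrite /hausdorff_gauge; case: ifPn => //; destruct pselect. Qed.

Lemma hausdorff_gauge_neq0 s A :
  A !=set0 -> hausdorff_gauge s A = (diam A `^ s)%E.
Proof.
move=> /set0P/eqP A0; rewrite /hausdorff_gauge; case: ifPn => //.
by destruct pselect.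
Qed.

Lemma hausdorff_gauge_ge0 s A : (0 <= hausdorff_gauge s A)%E.
Proof.
have [->|/set0P A0] := eqVneq A set0; first by rewrite hausdorff_gauge_set0.
by rewrite hausdorff_gauge_neq0// poweR_ge0.
Qed.

Lemma hausdorff_gauge_le s d A :
  0 <= s -> 0 <= d -> (diam A <= d%:E)%E -> (hausdorff_gauge s A <= (d `^ s)%:E)%E.
Proof.
move=> s0 d0 Ad; have [->|/set0P A0] := eqVneq A set0.
  by rewrite hausdorff_gauge_set0 lee_fin powR_ge0.
rewrite hausdorff_gauge_neq0// -poweR_EFin; apply: gt0_ler_poweR => //.
- by rewrite in_itv/= diam_ge0// leey.
- by rewrite in_itv/= lee_fin d0 leey.
Qed.

Lemma hausdorff_premeasure_ge0 s d A : (0 <= hausdorff_premeasure s d A)%E.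
Proof.
apply: le_ereal_inf_tmp => _ [B _ <-].
by apply: nneseries_ge0 => i _ _; exact: hausdorff_gauge_ge0.
Qed.

(** Every tail of the sequence of balls still covers [A], and far tails have small diameters and a
    small sum of powers. *)
Lemma hausdorff_outer_measure_limsup_eq0 (c r : nat -> R) K s A :
  0 < K -> 0 < s -> (forall i, 0 < r i) ->
  (\sum_(0 <= i <oo) (r i `^ s)%:E < +oo)%E ->
  (forall x, A x -> forall N, exists2 i, (N <= i)%N & `|x - c i| <= K * r i) ->
  hausdorff_outer_measure s A = 0.
Proof.
move=> K0 s0 r0 roo Ac.
have rs0 i : 0 <= r i `^ s by exact: powR_ge0.
apply/eqP; rewrite eq_le; apply/andP; split; last first.
  apply: le_trans (hausdorff_premeasure_ge0 s 1 A) _.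
  by apply: ereal_sup_ubound; exists 1 => //=.
apply: ge_ereal_sup => _ [d /= d0 <-].
apply/lee_addgt0Pr => e e0; rewrite add0e.
have K20 : 0 < 2 * K by rewrite mulr_gt0.
(* The first bound, applied to single terms of the tail, keeps the diameters below [d]; the second
   keeps the whole sum below [e]. *)
pose m := Num.min ((d / (2 * K)) `^ s) (e / (2 * K) `^ s).
have m0 : 0 < m by rewrite lt_min powR_gt0 ?divr_gt0// powR_gt0.
have [N rN] := nneseries_tail_lt m rs0 roo m0.
pose B i := [set x | `|x - c (i + N)%N| <= K * r (i + N)%N].
have Bdiam i : (diam (B i) <= (2 * K * r (i + N)%N)%:E)%E.
  apply: ge_ereal_sup => _ [[x y] [/= xB yB] <-]; rewrite lee_fin.
  rewrite -(subrKA (c (i + N)%N)) (le_trans (ler_normD _ _))//.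
  by rewrite -mulrA mulr2n mulrDl mul1r lerD// distrC.
have rB i : 2 * K * r (i + N)%N <= d.
  rewrite mulrC -ler_pdivlMr//.
  apply: (@powR_le_inv _ s) => //; [exact: ltW|exact/ltW/divr_gt0|].
  rewrite -lee_fin (@le_trans _ _ m%:E)//; last by rewrite lee_fin ge_min lexx.
  apply: le_trans (ltW rN).
  exact: (nneseries_ge_term (fun i => r (i + N)%N `^ s)).
apply: (@le_trans _ _ (\sum_(0 <= i <oo) hausdorff_gauge s (B i))%E).
  apply: ereal_inf_lbound; exists B => //; split => [x Ax|i].
    have [i Ni xi] := Ac _ Ax N.
    by exists (i - N)%N => //; rewrite /B/= subnK.
  by apply: le_trans (Bdiam i) _; rewrite lee_fin.
apply: (@le_trans _ _ (\sum_(0 <= i <oo) ((2 * K) `^ s)%:E * (r (i + N)%N `^ s)%:E)%E).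
  apply: lee_nneseries => [i _ _|i _]; first exact: hausdorff_gauge_ge0.
  rewrite -EFinM -powRM; [|exact: ltW..].
  apply: hausdorff_gauge_le => //; first exact: ltW.
  by rewrite mulr_ge0// ltW.
rewrite nneseriesZl; last by move=> i _; rewrite lee_fin.
rewrite muleC -lee_pdivlMr ?powR_gt0//.
apply: le_trans (ltW rN) _; rewrite -EFinM lee_fin.
by rewrite ge_min lexx orbT.
Qed.

Lemma hausdorff_dim_le theta A : 0 <= theta ->
  (forall s, theta < s -> hausdorff_outer_measure s A = 0) ->
  (hausdorff_dim A <= theta%:E)%E.
Proof.
move=> t0 As; apply/lee_addgt0Pr => e e0.
apply: ereal_inf_lbound; exists (theta + e); rewrite ?EFinD//; split.
  by rewrite addr_ge0// ltW.
by apply: As; rewrite ltrDl.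
Qed.

Lemma hausdorff_dim_ge theta A :
  (forall s, 0 <= s < theta -> hausdorff_outer_measure s A <> 0) ->
  (theta%:E <= hausdorff_dim A)%E.
Proof.
move=> As; apply: le_ereal_inf_tmp => _ [s [s0 sA] <-].
by rewrite lee_fin leNgt; apply/negP => st; apply: (As s) => //; rewrite s0.
Qed.

(* Each set B_i of a cover of the image of psi pulls back into an interval of
   length 2K (diam B_i)^s, and these intervals cover [0, del[. *)
Lemma hausdorff_outer_measure_neq0 (psi : R -> R) K del theta s A :
  0 < K -> 0 < del -> 0 < theta -> 0 <= s <= theta ->
  (forall t u, 0 <= t < del -> 0 <= u < del ->
    `|t - u| <= K * `|psi t - psi u| `^ theta) ->
  (forall t, 0 <= t < del -> A (psi t)) ->
  hausdorff_outer_measure s A <> 0.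
Proof.
move=> K0 del0 th0 /andP[s0 st] psiK psiA HA0.
(* A null set has a cover so cheap that the pulled-back intervals have total length less than [del],
   too little to cover [[0, del[]. *)
have : (hausdorff_premeasure s 1 A < (del / (2 * K))%:E)%E.
  apply: (@le_lt_trans _ _ 0%E); last by rewrite lte_fin divr_gt0// mulr_gt0.
  by rewrite -HA0; apply: ereal_sup_ubound; exists 1 => /=.
move=> /ereal_inf_lt[_ [B [AB B1] <-]] Bs.
pose T i := [set t | 0 <= t < del /\ B i (psi t)].
(* The centre of the i-th interval; the default 0 is harmless, since an empty [T i] has nothing to
   cover. *)
pose t_ i := xget 0 (T i).
pose g i := K * fine (hausdorff_gauge s (B i)).
have gfin i : hausdorff_gauge s (B i) \is a fin_num.
  rewrite ge0_fin_numE ?hausdorff_gauge_ge0//.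
  apply: le_lt_trans (hausdorff_gauge_le s 1 _ s0 ler01 (B1 i)) _.
  exact: ltry.
have g0 i : 0 <= g i.
  by rewrite mulr_ge0 ?fine_ge0 ?hausdorff_gauge_ge0//; exact: ltW.
pose D i := `[t_ i - g i, t_ i + g i]%classic.
have TD i : T i `<=` D i.
  move=> t [tdel tB].
  have /(xgetPex 0)[udel uB] : T i !=set0 by exists t.
  rewrite -/(t_ i) in udel uB.
  rewrite /D /= in_itv/= -ler_distlC distrC.
  apply: le_trans (psiK _ _ tdel udel) _; rewrite ler_pM2l//.
  set x := psi t in tB *; set y := psi (t_ i) in uB *.
  have xy1 : `|x - y| <= 1.
    by rewrite -lee_fin; apply: le_trans (diam_ge _ _ _ tB uB) (B1 i).
  (* As [|x - y| <= 1], the smaller exponent [s] gives the larger power. Distance 0 is separate: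
     there [0 ^ theta = 0], while [0 ^ s] may be 1. *)
  apply: (@le_trans _ _ (`|x - y| `^ s)).
    have [->|xy0] := eqVneq (`|x - y|) 0.
      by rewrite powR0 ?gt_eqF// powR_ge0.
    by rewrite ger_powR// xy1 lt_neqAle eq_sym xy0 normr_ge0.
  rewrite -lee_fin fineK//.
  rewrite hausdorff_gauge_neq0; last by exists x.
  rewrite -poweR_EFin; apply: gt0_ler_poweR => //; last exact: diam_ge.
  - by rewrite in_itv/= lee_fin normr_ge0 leey.
  - by rewrite in_itv/= diam_ge0 ?leey//; exists x.
have : (lebesgue_measure `[0%R, del[%classic <=
    \sum_(0 <= i <oo) lebesgue_measure (D i))%E.
  apply: measure_sigma_subadditive => [i||t].
  - exact: measurable_itv.
  - exact: measurable_itv.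
  - rewrite /= in_itv/= => tdel; have [i _ tB] := AB _ (psiA _ tdel).
    by exists i => //; apply: TD.
rewrite lebesgue_measure_itv/= lte_fin del0 oppr0 adde0.
apply/negP; rewrite -ltNge.
apply: (@le_lt_trans _ _ (\sum_(0 <= i <oo) (2 * K)%:E * hausdorff_gauge s (B i))%E).
  apply: lee_nneseries => // i _.
  rewrite lebesgue_measure_itv/= lte_fin; case: ifPn => _; last first.
    by rewrite mule_ge0 ?hausdorff_gauge_ge0// lee_fin mulr_ge0// ltW.
  rewrite -(fineK (gfin i)) -EFinB -EFinM lee_fin -mulrA -/(g i).
  lra.
rewrite nneseriesZl; last by move=> i _; exact: hausdorff_gauge_ge0.
by rewrite muleC -lte_pdivlMr ?mulr_gt0.
Qed.

End Hausdorff.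

(** * Sums of bumps *)

Lemma series_cvgry {R : realType} (u : nat -> R) :
  (forall n, 0 <= u n) -> (forall N, exists2 n, (N <= n)%N & 1 <= u n) ->
  series u @ \oo --> +oo.
Proof.
move=> u0 u1.
have ndu : nondecreasing_seq (series u) by apply: nondecreasing_series => n _ _.
have H (k : nat) : exists n, k%:R <= series u n.
  elim: k => [|k [N IH]]; first by exists 0%N; rewrite /series/= big_geq.
  have [n Nn un] := u1 N; exists n.+1.
  rewrite /series/= big_nat_recr//= -natr1 lerD//.
  by apply: le_trans IH _; exact: ndu.
apply/cvgryPge => A.
have [N AN] := H (Num.truncn A).+1.
exists N => // n /= Nn; apply: le_trans (ndu _ _ Nn); apply: le_trans AN.
exact/ltW/truncnS_gt.
Qed.

Section Bump.
Context {R : realType}.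
Implicit Types c r x y : R.

Definition bump c r x : R := r^-1 * Num.max 0 (2 - `|x - c| / r).

Lemma bump_ge0 c r x : 0 < r -> 0 <= bump c r x.
Proof. by move=> r0; rewrite /bump mulr_ge0 ?invr_ge0 ?le_max ?lexx// ltW. Qed.

Lemma bump_ge c r x : 0 < r -> `|x - c| <= r -> r^-1 <= bump c r x.
Proof.
move=> r0 xr; rewrite /bump ler_peMr ?invr_ge0 ?(ltW r0)// le_max.
by rewrite lerBrDr -lerBrDl (le_trans (y := 1)) ?ler_pdivrMr ?mul1r ?orbT//; lra.
Qed.

Lemma bump_eq0 c r x : 0 < r -> 2 * r <= `|x - c| -> bump c r x = 0.
Proof.
move=> r0 xr; rewrite /bump max_l ?mulr0//.
by rewrite subr_le0 ler_pdivlMr.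
Qed.

Lemma continuous_bump c r : continuous (bump c r).
Proof.
move=> x; apply: cvgM; first exact: cvg_cst.
apply: (@continuous_max _ _ (cst 0) (fun x => 2 - `|x - c| / r)).
  exact: cst_continuous.
apply: cvgB; first exact: cvg_cst.
apply: cvgM; last exact: cvg_cst.
by apply: cvg_norm; apply: cvgB; [exact: cvg_id|exact: cvg_cst].
Qed.

Lemma measurable_bump (D : set R) c r : measurable_fun D (bump c r).
Proof.
apply: measurable_funTS; apply: continuous_measurable_fun.
exact: continuous_bump.
Qed.

(** On [[c - r, c + r]], of length [2 * r], the bump is at least [1 / r]. *)
Lemma integral_bump_ge1 c r x y : 0 < r -> x <= c - r -> c + r <= y ->
  (1 <= \int[lebesgue_measure]_(t in `[x, y]) (bump c r t)%:E)%E.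
Proof.
move=> r0 xc cy.
have mb D : measurable_fun D (EFin \o bump c r).
  by apply/measurable_EFinP; exact: measurable_bump.
apply: (@le_trans _ _
  (\int[lebesgue_measure]_(t in `[(c - r)%R, (c + r)%R]) (bump c r t)%:E)%E); last first.
  apply: ge0_subset_integral => //=; [exact: mb| |].
    by move=> t _; rewrite lee_fin bump_ge0.
  by apply: subset_itv; rewrite bnd_simp.
apply: (@le_trans _ _
  (\int[lebesgue_measure]_(t in `[(c - r)%R, (c + r)%R]) (r^-1)%:E)%E).
  rewrite integral_cst//= lebesgue_measure_itv/= lte_fin.
  rewrite ifT; last by lra.
  rewrite -EFinB -EFinM lee_fin.
  rewrite (_ : c + r - (c - r) = 2 * r); last by lra.
  by rewrite mulrC -mulrA divff ?gt_eqF//; lra.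
apply: ge0_le_integral => //=.
- by move=> t _; rewrite lee_fin invr_ge0 ltW.
- exact: mb.
- move=> t; rewrite in_itv/= => /andP[t1 t2]; rewrite lee_fin bump_ge//.
  by rewrite ler_norml; lra.
Qed.

Section BumpSeries.
Variables (c r : nat -> R).
Hypothesis r0 : forall i, 0 < r i.
Hypothesis r_small : forall e : R, 0 < e -> exists N, forall i, (N <= i)%N -> r i <= e.

Definition bump_series n x := series (fun i => bump (c i) (r i) x) n.

(** Once the radii are at most 1, each ball that contains [x] adds at least [1 / r i >= 1] to the
    sum. *)
Lemma bump_series_cvgry x :
  (forall N, exists2 i, (N <= i)%N & `|x - c i| <= r i) ->
  bump_series n x @[n --> \oo] --> +oo.
Proof.
move=> xc; apply: series_cvgry => [n|N]; first exact: bump_ge0.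
have [M rM] := r_small _ ltr01.
have [i Ni xi] := xc (maxn M N).
exists i; first by apply: leq_trans Ni; rewrite leq_maxr.
apply: le_trans (bump_ge _ _ _ (r0 i) xi).
by rewrite invf_ge1// rM//; apply: leq_trans Ni; rewrite leq_maxl.
Qed.

(** If [x] avoided all doubled balls from index [N] on, the partial sums at [x] would be constant
    from there. *)
Lemma bump_series_cvgry_near x :
  bump_series n x @[n --> \oo] --> +oo ->
  forall N, exists2 i, (N <= i)%N & `|x - c i| <= 2 * r i.
Proof.
move=> xoo N; apply: contrapT => xN.
have bN i : (N <= i)%N -> bump (c i) (r i) x = 0.
  move=> Ni; apply: bump_eq0 => //; rewrite leNgt; apply/negP => xi.
  by apply: xN; exists i; [exact: Ni|exact: ltW].
move/cvgryPgt : xoo => /(_ (bump_series N x))[M _ MP].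
have := MP (maxn M N) (leq_maxl _ _).
rewrite /= /bump_series /series/= (big_cat_nat (leq0n N) (leq_maxr M N))/=.
rewrite [X in _ + X]big_nat_cond [X in _ + X]big1 ?addr0 ?ltxx//.
by move=> i /andP[/andP[Ni _] _]; exact: bN.
Qed.

Lemma max_family_bump_series (I : set R) :
  (forall x y, x < y -> exists2 e, x < e < y &
     forall N, exists2 i, (N <= i)%N & `|e - c i| <= r i) ->
  max_family I bump_series.
Proof.
move=> dense; split.
- move=> n; apply: continuous_subspaceT.
  by apply: continuous_big => [|i _]; [exact: add_continuous|exact: continuous_bump].
- by move=> x _; apply: nondecreasing_series => n _ _; exact: bump_ge0.
- move=> x y _ _ xy.
  have [e /andP[xe ey] ec] := dense _ _ xy.
  (* The indicator that the i-th ball lies in [[x, y]], a lower bound for the integral of the i-th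
     bump. *)
  pose v i : R := if (x <= c i - r i) && (c i + r i <= y) then 1 else 0.
  have v0 i : 0 <= v i by rewrite /v; case: ifP.
  have : series v @ \oo --> +oo.
    apply: series_cvgry => // N.
    (* A ball through [e] stays within twice its radius of [e], so half the distance to the
       endpoints keeps it inside [[x, y]]. *)
    have e0 : 0 < Num.min (e - x) (y - e) / 2.
      by rewrite divr_gt0// lt_min !subr_gt0 xe.
    have [M rM] := r_small _ e0.
    have [i Ni ei] := ec (maxn M N).
    exists i; first by apply: leq_trans Ni; rewrite leq_maxr.
    have := rM i (leq_trans (leq_maxl _ _) Ni).
    rewrite ler_pdivlMr// le_min => /andP[r1 r2].
    move: ei; rewrite ler_norml => /andP[e1 e2].
    by rewrite /v ifT//; apply/andP; split; lra.
  move=> /cvgryPge voo; apply/cvgeyPge => A.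
  have [N _ NP] := voo A.
  exists N => // n /= /NP /= An.
  apply: (@le_trans _ _ (series v n)%:E); first by rewrite lee_fin.
  rewrite /bump_series /series/=.
  under eq_integral do rewrite -sumEFin.
  rewrite ge0_integral_sum//=; last 2 first.
  - by move=> i; apply/measurable_EFinP; exact: measurable_bump.
  - by move=> i t _; rewrite lee_fin bump_ge0.
  rewrite -sumEFin; apply: lee_sum => i _.
  rewrite /v; case: ifPn => [/andP[h1 h2]|_]; first exact: integral_bump_ge1.
  by apply: integral_ge0 => t _; rewrite lee_fin bump_ge0.
Qed.

End BumpSeries.
End Bump.

(** * The parametrized Cantor set *)

Section DyadicJump.
Context {R : realType}.
Implicit Types (t u lam : R) (n N : nat).

(* The largest multiple of 2^-N that is at most t (for t >= 0). *)
Definition dyadic_trunc N t : R := (Num.truncn (2 ^+ N * t))%:R / 2 ^+ N.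

Lemma dyadic_trunc_itv N t :
  0 <= t -> dyadic_trunc N t <= t < dyadic_trunc N t + 2 ^- N.
Proof.
move=> t0; have P : 0 < 2 ^+ N :> R by exact: exprn_gt0.
have /andP[h1 h2] := truncn_itv (mulr_ge0 (ltW P) t0).
rewrite /dyadic_trunc ler_pdivrMr// [t * _]mulrC h1/=.
by rewrite -{2}[2 ^- N]mul1r -mulrDl natr1 ltr_pdivlMr// mulrC.
Qed.

Lemma dyadic_trunc_ge0 N t : 0 <= dyadic_trunc N t.
Proof. by rewrite divr_ge0. Qed.

(** Truncation at level [N] keeps the first [N] binary digits, and the floor of [2^n t] depends only
    on the first [n]. *)
Lemma truncn_dyadic_trunc_le n N t : (n <= N)%N -> 0 <= t ->
  Num.truncn (2 ^+ n * dyadic_trunc N t) = Num.truncn (2 ^+ n * t).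
Proof.
move=> nN t0; have P k : 0 < 2 ^+ k :> R by exact: exprn_gt0.
have /andP[tt _] := dyadic_trunc_itv N _ t0.
apply/eqP; rewrite eqn_leq le_truncn ?ler_pM2l//=.
rewrite truncn_ge_nat; last by rewrite mulr_ge0 ?dyadic_trunc_ge0.
rewrite /dyadic_trunc mulrA ler_pdivlMr// mulrC -(subnKC nN) exprD -mulrA.
rewrite ler_pM2l// -natrX -natrM ler_nat truncn_ge_nat; last by rewrite !mulr_ge0.
rewrite natrM natrX mulrAC mulrC ler_pM2r//.
by rewrite truncn_le mulr_ge0.
Qed.

Lemma truncn_dyadic_trunc_ge n N t : (N <= n)%N ->
  (Num.truncn (2 ^+ n * dyadic_trunc N t))%:R = 2 ^+ n * dyadic_trunc N t.
Proof.
move=> Nn; rewrite /dyadic_trunc; set j := Num.truncn (2 ^+ N * t).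
suff -> : 2 ^+ n * (j%:R / 2 ^+ N) = (2 ^ (n - N) * j)%:R :> R by rewrite natrK.
rewrite -{1}(subnK Nn) exprD natrM natrX -mulrA; congr (_ * _).
by rewrite mulrCA divff ?mulr1// expf_neq0.
Qed.

Definition dyadic_jump lam t : R :=
  limn (series (fun n => lam ^+ n * (Num.truncn (2 ^+ n * t))%:R)).

Section Contraction.
Variable lam : R.
Hypotheses (lam0 : 0 < lam) (lam1 : 2 * lam < 1).

Let term t n := lam ^+ n * (Num.truncn (2 ^+ n * t))%:R.

Let term_ge0 t n : 0 <= term t n.
Proof. by rewrite mulr_ge0// exprn_ge0// ltW. Qed.

Let lam2_norm : `|2 * lam| < 1.
Proof. by rewrite ger0_norm// mulr_ge0// ltW. Qed.

(** The floor of [2^n t] is at most [2^n], so the geometric series of ratio [2 * lam] dominates. *)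
Lemma is_cvg_dyadic_jump t : 0 <= t < 1 -> cvgn (series (term t)).
Proof.
move=> /andP[t0 t1]; apply: nondecreasing_is_cvgn.
  by apply: nondecreasing_series => n _ _; exact: term_ge0.
exists (1 / (1 - 2 * lam)) => _ [n _ <-].
apply: le_trans (geometric_le_lim n ler01 _ lam2_norm); last by rewrite mulr_gt0.
apply: ler_sum => i _; rewrite /term /= mul1r exprMn mulrC.
rewrite ler_wpM2r ?exprn_ge0 ?(ltW lam0)//.
have P : 0 < 2 ^+ i :> R by exact: exprn_gt0.
apply: (@le_trans _ _ (2 ^+ i * t)); first by rewrite truncn_le mulr_ge0// ltW.
by rewrite ler_piMr ?ltW.
Qed.

Lemma dyadic_jump0 : dyadic_jump lam 0 = 0.
Proof.
rewrite /dyadic_jump (_ : series _ = cst 0) ?lim_cst//.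
apply/funext => n; rewrite /series/= big1// => i _.
by rewrite mulr0 truncn0 mulr0.
Qed.

(** For [t <= u] these partial differences are nonnegative and increase to the difference of the
    limits, so each of them bounds it from below. *)
Let jump t u n := series (term u) n - series (term t) n.

Let cvg_jump t u : 0 <= t < 1 -> 0 <= u < 1 ->
  jump t u @ \oo --> dyadic_jump lam u - dyadic_jump lam t.
Proof. by move=> t01 u01; apply: cvgB; exact: is_cvg_dyadic_jump. Qed.

Let jumpS t u n : jump t u n.+1 = jump t u n + (term u n - term t n).
Proof. by rewrite /jump /series/= !big_nat_recr//= opprD addrACA. Qed.

Let term_le t u n : t <= u -> term t n <= term u n.
Proof.
move=> tu; rewrite ler_wpM2l ?exprn_ge0 ?(ltW lam0)// ler_nat le_truncn//.
by rewrite ler_pM2l ?exprn_gt0.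
Qed.

Let nondecreasing_jump t u : t <= u -> nondecreasing_seq (jump t u).
Proof.
by move=> tu; apply/nondecreasing_seqP => n; rewrite jumpS lerDl subr_ge0 term_le.
Qed.

Let jump_ge0 t u n : t <= u -> 0 <= jump t u n.
Proof.
move=> tu; rewrite subr_ge0; apply: ler_sum => i _; exact: term_le.
Qed.

Lemma dyadic_jump_le t u : 0 <= t -> t <= u -> u < 1 ->
  dyadic_jump lam t <= dyadic_jump lam u.
Proof.
move=> t0 tu u1; rewrite -subr_ge0.
have c : jump t u @ \oo --> dyadic_jump lam u - dyadic_jump lam t.
  by apply: cvg_jump; apply/andP; split => //; [exact: le_lt_trans u1|exact: le_trans tu].
rewrite -(cvg_lim _ c)//; apply: limr_ge; first exact: cvgP c.
by apply: nearW => n; exact: jump_ge0.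
Qed.

(** Here [2^n u >= 2^n t + 1], so the floors differ by at least 1 and the n-th term alone
    contributes [lam^n]. *)
Lemma dyadic_jump_ge n t u : 0 <= t -> u < 1 -> t + 2 ^- n <= u ->
  lam ^+ n <= dyadic_jump lam u - dyadic_jump lam t.
Proof.
move=> t0 u1 tnu; have P : 0 < 2 ^+ n :> R by exact: exprn_gt0.
have tu : t <= u by apply: le_trans tnu; rewrite lerDl invr_ge0 ltW.
have c : jump t u @ \oo --> dyadic_jump lam u - dyadic_jump lam t.
  by apply: cvg_jump; apply/andP; split => //; [exact: le_lt_trans u1|exact: le_trans tu].
rewrite -(cvg_lim _ c)//.
apply: le_trans (nondecreasing_cvgn_le (nondecreasing_jump _ _ tu) (cvgP _ c) n.+1).
rewrite jumpS -[leLHS]add0r lerD ?jump_ge0// /term -mulrBr.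
rewrite ler_peMr ?exprn_ge0 ?(ltW lam0)//.
rewrite lerBrDr nat1r ler_nat truncn_ge_nat; last first.
  by rewrite mulr_ge0 ?(ltW P)// (le_trans t0).
rewrite -natr1; apply: (@le_trans _ _ (2 ^+ n * t + 1)).
  by rewrite lerD2r truncn_le mulr_ge0// ltW.
have -> : 2 ^+ n * t + 1 = 2 ^+ n * (t + 2 ^- n) by rewrite mulrDr mulfV ?gt_eqF.
by rewrite ler_pM2l.
Qed.

(** The terms below index [N] cancel. For [n >= N] the floors differ by at most [2^n 2^-N], which
    leaves [2^-N] times the tail of a geometric series of ratio [2 * lam]. *)
Lemma dyadic_jump_trunc N t : 0 <= t < 1 ->
  `|dyadic_jump lam t - dyadic_jump lam (dyadic_trunc N t)| <=
    (1 - 2 * lam)^-1 * lam ^+ N.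
Proof.
move=> /andP[t0 t1]; set v := dyadic_trunc N t.
have v0 : 0 <= v by exact: dyadic_trunc_ge0.
have /andP[vt tv] : v <= t < v + 2 ^- N by exact: dyadic_trunc_itv.
have c : jump v t @ \oo --> dyadic_jump lam t - dyadic_jump lam v.
  by apply: cvg_jump; apply/andP; split => //; exact: le_lt_trans t1.
rewrite ger0_norm ?subr_ge0 ?dyadic_jump_le//.
rewrite -(cvg_lim _ c)//; apply: limr_le; first exact: cvgP c.
exists N => // m /= Nm; rewrite -(subnKC Nm).
have P k : 0 < 2 ^+ k :> R by exact: exprn_gt0.
have jN : jump v t N = 0.
  apply/eqP; rewrite subr_eq0; apply/eqP; rewrite /series/= !big_mkord.
  by apply: eq_bigr => i _; rewrite /term truncn_dyadic_trunc_le// ltnW.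
have jM k : jump v t (N + k) <= 2 ^- N * \sum_(N <= i < N + k) (2 * lam) ^+ i.
  elim: k => [|k IH]; first by rewrite addn0 jN big_geq// mulr0.
  rewrite addnS jumpS big_nat_recr ?leq_addr//= mulrDr lerD//.
  rewrite /term truncn_dyadic_trunc_ge ?leq_addr// -mulrBr exprMn.
  rewrite [leRHS]mulrA [leRHS]mulrC.
  rewrite ler_wpM2l ?exprn_ge0 ?(ltW lam0)//.
  apply: (@le_trans _ _ (2 ^+ (N + k) * t - 2 ^+ (N + k) * v)).
    by rewrite lerD2r truncn_le mulr_ge0// ltW.
  by rewrite -mulrBr mulrC ler_pM2r// lerBlDl ltW.
apply: le_trans (jM _) _; rewrite geometric_partial_tail.
rewrite mulrC ler_pdivrMr//; apply: le_trans (geometric_le_lim _ _ _ lam2_norm) _.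
- by rewrite exprn_ge0// mulr_ge0// ltW.
- by rewrite mulr_gt0.
- by rewrite exprMn mulrC -mulrA [lam ^+ N * _]mulrC.
Qed.

End Contraction.

(** The scaling relation behind the dimension: halving the parameter scales the image by [lam], and
    [lam^theta = 1/2]. *)
Lemma half_powR_inv theta : 0 < theta ->
  (2 `^ (- theta^-1) : R) `^ theta = 2^-1.
Proof. by move=> th0; rewrite -powRrM mulNr mulVf ?gt_eqF// powR_inv1. Qed.

Lemma dyadic_parametrization (theta : R) : 0 < theta <= 1 ->
  exists psi : R -> R, exists K : R,
    [/\ 0 < K, psi 0 = 0,
        forall t u, 0 <= t < 1 -> 0 <= u < 1 ->
          `|t - u| <= K * `|psi t - psi u| `^ theta &
        forall N t, 0 <= t < 1 ->
          `|psi t - psi (dyadic_trunc N t)| <= K * (2 `^ (- theta^-1)) ^+ N].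
Proof.
move=> /andP[th0]; rewrite le_eqVlt => /orP[/eqP ->|th1].
  (* For [theta = 1] the ratio [lam] would be 1/2 and the jump series would diverge for [t > 0]. *)
  exists id, 1; split => // [t u _ _|N t /andP[t0 t1]].
    by rewrite powRr1// mul1r.
  rewrite invr1 powR_inv1// mul1r.
  have /andP[h1 h2] := dyadic_trunc_itv N _ t0.
  by rewrite ger0_norm ?subr_ge0// exprVn lerBlDl ltW.
set lam := 2 `^ (- theta^-1).
have lam0 : 0 < lam by rewrite powR_gt0.
have lam1 : 2 * lam < 1.
  rewrite -ltr_pdivlMl// mulr1 -[ltRHS]powR_inv1// /lam.
  rewrite /powR (gt_eqF (_ : 0 < 2))// ltr_expR ltr_pM2r ?ln_gt0 ?ltr1n//.
  by rewrite ltrN2 invf_gt1.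
(* The summand 2 serves the expansion bound, the other one the dyadic bound. *)
pose K : R := 2 + (1 - 2 * lam)^-1.
have L0 : 0 < (1 - 2 * lam)^-1 by rewrite invr_gt0 subr_gt0.
exists (dyadic_jump lam), K; split.
- by rewrite addr_gt0.
- exact: dyadic_jump0.
- have H t u : 0 <= t -> t < u -> u < 1 ->
      `|t - u| <= K * `|dyadic_jump lam t - dyadic_jump lam u| `^ theta.
    move=> t0 tu u1.
    have exn : exists n : nat, 2 ^- n <= u - t.
      have [k hk] := ltr_add_invr tu.
      exists k; rewrite lerBrDl; apply: le_trans (ltW hk); rewrite lerD2l.
      by rewrite lef_pV2 ?posrE ?exprn_gt0// -natrX ler_nat ltn_expl.
    (* The least [n] with [2^-n <= u - t] is not 0, since [u - t < 1]. Minimality gives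
       [u - t < 2^-m = 2 (lam^(m+1))^theta]. *)
    case: (ex_minnP exn) => -[|m] hm mmin.
      by move: hm; rewrite expr0 invr1; lra.
    have mt : u - t < 2 ^- m.
      by rewrite ltNge; apply/negP => /mmin; rewrite ltnn.
    have : lam ^+ m.+1 <= dyadic_jump lam u - dyadic_jump lam t.
      by apply: dyadic_jump_ge => //; rewrite -lerBrDl.
    move=> lm; rewrite distrC ger0_norm ?subr_ge0 ?(ltW tu)// distrC.
    have lm0 : 0 <= lam ^+ m.+1 by rewrite exprn_ge0// ltW.
    rewrite ger0_norm; last exact: le_trans lm.
    apply: (@le_trans _ _ (2 * (lam ^+ m.+1) `^ theta)).
      rewrite -powR_mulrn ?(ltW lam0)// powRAC half_powR_inv// powR_mulrn// exprVn.
      by rewrite exprS invfM mulrA divff// mul1r ltW.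
    apply: ler_pM => //; first exact: powR_ge0.
      by rewrite lerDl ltW.
    by apply: ge0_ler_powR; rewrite ?nnegrE ?(ltW th0)// (le_trans lm0).
  move=> t u /andP[t0 t1] /andP[u0 u1].
  have [tu|ut|->] := ltgtP t u; first exact: H.
    by rewrite distrC [X in X `^ _]distrC; exact: H.
  by rewrite !subrr normr0 mulr_ge0 ?powR_ge0// addr_ge0// ltW.
- move=> N t t01; apply: le_trans (dyadic_jump_trunc _ lam0 lam1 N _ t01) _.
  by rewrite ler_wpM2r ?exprn_ge0 ?(ltW lam0)// lerDr.
Qed.

End DyadicJump.

(** * Limsup covers of points and Cantor sets *)

Section Covers.
Context {R : realType}.
Implicit Types (theta q x s : R).

Lemma powR_lt1 x s : 0 <= x < 1 -> 0 < s -> x `^ s < 1.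
Proof.
move=> /andP[x0 x1] s0; rewrite -(congr1 (fun f => f s) (@powR1 R)).
by apply: gt0_ltr_powR; rewrite ?nnegrE.
Qed.

Lemma powR_exprn x s n : 0 <= x -> (x ^+ n) `^ s = (x `^ s) ^+ n.
Proof. by move=> x0; rewrite -powR_mulrn// powRAC powR_mulrn// powR_ge0. Qed.

Lemma limsup_cover_set1 theta q : 0 <= theta -> limsup_cover theta [set q].
Proof.
move=> th0; exists (cst q), (fun i => 2^-1 ^+ i); split=> [i|s ths|x -> N].
- by rewrite exprn_gt0.
- apply: (@nneseries_lty _ _ (1 / (1 - 2^-1 `^ s))) => [n|n]; first exact: powR_ge0.
  under eq_fun do rewrite powR_exprn//.
  rewrite exprn_geometric; apply: geometric_le_lim => //.
  rewrite ger0_norm ?powR_ge0// powR_lt1 ?(le_lt_trans th0)//.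
  by rewrite invr_ge0 ler0n invf_lt1// ltr1n.
- by exists N => //; rewrite subrr normr0 exprn_ge0.
Qed.

(** Exactly [2^m] indices [k], those with [2^m <= k + 1 < 2^(m+1)], have logarithm [m]. *)
Lemma sum_trunc_log2 x M :
  \sum_(0 <= k < (2 ^ M).-1) x ^+ trunc_log 2 k.+1 = \sum_(0 <= m < M) (2 * x) ^+ m.
Proof.
elim: M => [|M IH]; first by rewrite !big_geq.
have M2 : ((2 ^ M).-1 <= (2 ^ M.+1).-1)%N by have := expn_gt0 2 M; rewrite expnS; lia.
rewrite (big_cat_nat (leq0n _) M2)/= IH big_nat_recr//=; congr (_ + _).
rewrite (eq_big_nat _ _ (F2 := fun=> x ^+ M)); last first.
  move=> k /andP[k1 k2]; rewrite (@trunc_log_eq _ M)//.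
  by move: k1 k2; rewrite -!subn1; lia.
rewrite sumr_const_nat -[LHS]mulr_natl exprMn; congr (_ * _).
rewrite -natrX; congr (_%:R).
have := expn_gt0 2 M; rewrite expnS => /=; lia.
Qed.

Variables (theta K : R) (psi : R -> R).
Hypotheses (th0 : 0 < theta) (K0 : 0 < K) (psi0 : psi 0 = 0).
Let lam : R := 2 `^ (- theta^-1).
Hypothesis psi_holder : forall t u, 0 <= t < 1 -> 0 <= u < 1 ->
  `|t - u| <= K * `|psi t - psi u| `^ theta.
Hypothesis psi_dyadic : forall N t, 0 <= t < 1 ->
  `|psi t - psi (dyadic_trunc N t)| <= K * lam ^+ N.

Let lam0 : 0 < lam.
Proof. exact: powR_gt0. Qed.

Let lam1 : lam < 1.
Proof.
rewrite ltNge; apply/negP => l1.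
have := ge0_ler_powR (ltW th0) (_ : 1 \in Num.nneg) (_ : lam \in Num.nneg) l1.
rewrite !nnegrE (ltW lam0) ler01 powR1 half_powR_inv// => /(_ isT isT).
by rewrite leNgt invf_lt1 ?ltr1n.
Qed.

(* The ball with index k = 2^N + j - 1, j < 2^N, is the one that contains the
   translate of the image of [j / 2^N, (j + 1) / 2^N[. *)
Lemma limsup_cover_translate q :
  limsup_cover theta [set q + psi t | t in [set t | 0 <= t < 1]].
Proof.
pose N_ k := trunc_log 2 k.+1.
exists (fun k => q + psi ((k.+1 - 2 ^ N_ k)%:R / 2 ^+ N_ k)),
       (fun k => K * lam ^+ N_ k); split=> [i|s ths|_ [t t01 <-] N].
- by rewrite mulr_gt0// exprn_gt0.
- have x0 : 0 < lam `^ s by exact: powR_gt0.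
  (* Level [m] has [2^m] balls of radius [K lam^m], so the sum is geometric of ratio [2 lam^s], and
     [2 lam^theta = 1]. *)
  have x1 : 2 * lam `^ s < 1.
    rewrite -ltr_pdivlMl// mulr1 -(half_powR_inv _ th0) -/lam.
    have -> : s = theta + (s - theta) by rewrite subrKC.
    rewrite powRD; last by rewrite (gt_eqF lam0) implybT.
    by rewrite gtr_pMr ?powR_gt0// powR_lt1 ?subr_gt0 ?ltW.
  apply: (@nneseries_lty _ _ (K `^ s * (1 / (1 - 2 * lam `^ s)))) => [n|n].
    exact: powR_ge0.
  have nM : (n <= (2 ^ n.+1).-1)%N by have := ltn_expl n.+1 (ltnSn 1); lia.
  apply: le_trans (nondecreasing_series _ nM) _; first by move=> *; exact: powR_ge0.
  rewrite /series/=.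
  under eq_bigr do rewrite powRM ?ltW ?exprn_gt0// powR_exprn ?ltW//.
  rewrite -mulr_sumr ler_wpM2l ?powR_ge0// sum_trunc_log2.
  have := @geometric_le_lim R n.+1 1 (2 * lam `^ s) ler01.
  rewrite -exprn_geometric; apply; first by rewrite mulr_gt0.
  by rewrite ger0_norm// mulr_ge0// ltW.
- have /andP[t0 t1] := t01.
  pose j := Num.truncn (2 ^+ N * t).
  have jN : (j < 2 ^ N)%N.
    by rewrite truncn_lt_nat ?mulr_ge0 ?exprn_ge0// natrX gtr_pMr ?exprn_gt0.
  have N2 := ltn_expl N (ltnSn 1).
  have kE : (2 ^ N + j).-1.+1 = (2 ^ N + j)%N by lia.
  have NE : N_ (2 ^ N + j).-1 = N.
    by rewrite /N_ kE; apply: trunc_log_eq => //; rewrite expnS; lia.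
  (* Level [N] itself suffices, because all its indices are at least [2^N - 1 >= N]. *)
  exists (2 ^ N + j).-1; first by lia.
  rewrite NE kE addKn.
  by rewrite opprD addrACA subrr add0r; exact: psi_dyadic.
Qed.

(** Near 0 the values of [psi] are close to [psi 0 = 0], so [A] contains the translated image of a
    short interval [[0, 2^-N[], to which the Lebesgue comparison applies. *)
Lemma hausdorff_dim_ge_translate (A : set R) x q y : x < q < y ->
  (forall t, 0 <= t < 1 -> x < q + psi t < y -> A (q + psi t)) ->
  (theta%:E <= hausdorff_dim A)%E.
Proof.
move=> /andP[xq qy] psiA.
have e0 : 0 < Num.min (q - x) (y - q) by rewrite lt_min !subr_gt0 xq.
have [N _ /(_ N (leqnn N))/= KN] : \forall n \near \oo,
    `|geometric K lam n| < Num.min (q - x) (y - q).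
  by apply: cvgr0_norm_lt => //; apply: cvg_geometric; rewrite ger0_norm// ltW.
have N2 : 0 < 2 ^+ N :> R by exact: exprn_gt0.
have N1 : 2 ^- N <= 1 :> R by rewrite invf_le1// exprn_ege1// ler1n.
apply: hausdorff_dim_ge => s /andP[s0 sth].
apply: (@hausdorff_outer_measure_neq0 _ (fun t => q + psi t) K (2 ^- N) theta) => //.
- by rewrite s0 ltW.
- move=> t u /andP[t0 tN] /andP[u0 uN].
  rewrite opprD addrACA subrr add0r; apply: psi_holder.
    by rewrite t0 (lt_le_trans tN).
  by rewrite u0 (lt_le_trans uN).
- move=> t /andP[t0 tN].
  have t01 : 0 <= t < 1 by rewrite t0 (lt_le_trans tN).
  apply: psiA => //.
  (* The truncation of [t < 2^-N] is 0, so this bounds [|psi t|] by [K lam^N]. *)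
  have := psi_dyadic N _ t01.
  have -> : dyadic_trunc N t = 0.
    rewrite /dyadic_trunc (_ : Num.truncn _ = 0%N) ?mul0r//.
    apply/eqP; rewrite -leqn0 -ltnS truncn_lt_nat ?mulr_ge0 ?(ltW N2)//.
    by rewrite -ltr_pdivlMl// mulr1.
  rewrite psi0 subr0 => /le_lt_trans/(_ (le_lt_trans (ler_norm _) KN)).
  by rewrite lt_min !ltr_norml => /andP[/andP[? ?] /andP[? ?]]; lra.
Qed.

End Covers.

(** * The max-family *)

(** A point [z] of the intersection may be an endpoint of [I], so the open interval is taken on the
    side of [z] where another point [w] of [I] lies. *)
Lemma relatively_open_itv {R : realType} (I V : set R) :
  is_interval I -> (exists x y, [/\ I x, I y & x < y]) -> open V ->
  (I `&` V) !=set0 ->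
  exists a b, a < b /\ forall z, a < z < b -> (I `&` V) z.
Proof.
move=> itvI [x [y [Ix Iy xy]]] oV [z [Iz Vz]].
have /nbhs_ballP[e /= e0 zeV] : nbhs z V by exact: open_nbhs_nbhs.
have [w Iw wz] : exists2 w, I w & w != z.
  by have [<-|xz] := eqVneq x z; [exists y; rewrite ?gt_eqF|exists x].
have Ve u : z - e < u < z + e -> V u.
  by move=> /andP[? ?]; apply: zeV; rewrite /ball/= ltr_norml; lra.
move: wz; rewrite neq_lt => /orP[wz|zw].
- exists (Num.max w (z - e)), z; split; first by rewrite gt_max wz gtrBl.
  move=> u /andP[]; rewrite gt_max => /andP[wu zu] uz; split.
    by apply: (itvI w z) => //; rewrite !ltW.
  by apply: Ve; rewrite zu (lt_trans uz)// ltrDl.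
- exists z, (Num.min w (z + e)); split; first by rewrite lt_min zw ltrDl.
  move=> u /andP[zu]; rewrite lt_min => /andP[uw ue]; split.
    by apply: (itvI z w) => //; rewrite !ltW.
  by apply: Ve; rewrite ue andbT (lt_trans _ zu)// gtrBl.
Qed.

Lemma max_family_of_limsup_cover {R : realType} (theta : R) (E : set R) :
  0 <= theta -> limsup_cover theta E ->
  (forall x y, x < y -> exists2 e, x < e < y & E e) ->
  (forall x y (A : set R), x < y -> (forall e, E e -> x < e < y -> A e) ->
    (theta%:E <= hausdorff_dim A)%E) ->
  forall I : set R, is_interval I -> (exists x y, [/\ I x, I y & x < y]) ->
  exists f : nat -> R -> R,
    max_family I f /\
    forall U : set R,
      is_interval U -> U !=set0 -> (exists2 V, open V & U = I `&` V) ->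
      hausdorff_dim (blowup_set I f `&` U) = theta%:E.
Proof.
move=> th0 [c [r [r0 rsum Ec]]] Edense Edim I itvI ndI.
have r_small (e : R) : 0 < e -> exists N, forall i, (N <= i)%N -> r i <= e.
  (* Summability for any one exponent above [theta] forces the radii to 0. *)
  move=> e0; pose s := theta + 1.
  have ths : theta < s by rewrite ltrDl.
  have s0 : 0 < s by exact: le_lt_trans ths.
  have rs0 i : 0 <= r i `^ s by exact: powR_ge0.
  have [N NP] := nneseries_tail_lt (e `^ s) rs0 (rsum s ths) (powR_gt0 s e0).
  exists N => i Ni; apply: (@powR_le_inv _ s) => //; [exact: ltW|exact: ltW|].
  rewrite -lee_fin; apply: le_trans (ltW NP).
  have := nneseries_ge_term (fun n => r (n + N)%N `^ s) (i - N)%N.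
  by rewrite subnK//; apply.
exists (bump_series c r); split.
  apply: max_family_bump_series => // x y xy.
  by have [e exy Ee] := Edense _ _ xy; exists e => //; exact: Ec.
move=> U _ U0 [V oV UIV]; apply/eqP; rewrite eq_le; apply/andP; split.
  apply: hausdorff_dim_le => // s ths.
  apply: (@hausdorff_outer_measure_limsup_eq0 _ c r 2) => //.
  - exact: le_lt_trans ths.
  - exact: rsum.
  - by move=> x [[_ xoo] _]; exact: bump_series_cvgry_near.
rewrite UIV in U0 *.
have [a [b [ab abU]]] := relatively_open_itv _ _ itvI ndI oV U0.
apply: Edim ab _ => e Ee /abU[Ie Ve]; split; split => //.
by apply: bump_series_cvgry => //; exact: Ec.
Qed.

Theorem theorem2 (R : realType) (I : set R) (theta : R) :
  is_interval I -> (exists x y, [/\ I x, I y & x < y]) ->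
  0 <= theta <= 1 ->
  exists f : nat -> R -> R,
    max_family I f /\
    forall U : set R,
      is_interval U -> U !=set0 -> (exists2 V, open V & U = I `&` V) ->
      hausdorff_dim (blowup_set I f `&` U) = theta%:E.
Proof.
move=> itvI ndI /andP[th0 th1].
(* An enumeration of the rationals; codes that do not decode give 0. *)
pose q k : R := ratr (odflt 0 (unpickle k : option rat)).
have q_dense x y : x < y -> exists k, x < q k < y.
  move=> /rat_in_itvoo[p]; rewrite in_itv/= => pxy.
  by exists (pickle p); rewrite /q pickleK.
have [th00|thN0] := eqVneq theta 0.
  apply: (@max_family_of_limsup_cover _ theta (\bigcup_k [set q k])) => //.
  - by apply: limsup_cover_bigcup => // k; exact: limsup_cover_set1.
  - by move=> x y /q_dense[k kxy]; exists (q k) => //; exists k.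
  (* The lower bound is vacuous: no [s] satisfies [0 <= s < 0]. *)
  - move=> x y A _ _; apply: hausdorff_dim_ge => s.
    by rewrite th00 => /andP[s0] /(le_lt_trans s0); rewrite ltxx.
have {}th0 : 0 < theta by rewrite lt_neqAle eq_sym thN0.
have th01 : 0 < theta <= 1 by rewrite th0.
have [psi [K [K0 psi0 psiH psiD]]] := dyadic_parametrization theta th01.
pose E := \bigcup_k [set q k + psi t | t in [set t | 0 <= t < 1]].
apply: (@max_family_of_limsup_cover _ theta E) => //; first exact: ltW.
- apply: limsup_cover_bigcup => [|k]; first exact: ltW.
  exact: limsup_cover_translate th0 K0 psiD _.
- move=> x y /q_dense[k kxy]; exists (q k) => //.
  (* Since [psi 0 = 0], the set [E] contains the rationals and is therefore dense. *)
  by exists k => //; exists 0 => /=; rewrite ?psi0 ?addr0 ?lexx ?ltr01.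
- move=> x y A /q_dense[k kxy] EA.
  apply: (hausdorff_dim_ge_translate _ _ _ th0 K0 psi0 psiH psiD _ _ _ _ kxy).
  by move=> t t01; apply: EA; exists k => //; exists t.
Qed.
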